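(* Let $\epsilon\in(0,\frac{1}{3N})$ and $\psi_{in}\in\mathbb{R}^N$. The parameter shuffling routine (described in the context) with tolerance $\epsilon$ and input $\psi_{in}$ terminates in at most $$(N-1)\left(\frac{4L\|c\|_\infty}{\epsilon}+1\right)$$ steps, where $L$ is the Lipschitz constant of $G$.
   Context: Setting. $N\ge1$, $n\ge2$ are integers, $X\subset\mathbb{R}^n$ is compact, $Y=\{y_1,\dots,y_N\}\subset\mathbb{R}^n$ consists of $N$ distinct points, $c:X\times Y\to\mathbb{R}$, $\|c\|_\infty=\sup_{X\times Y}|c|$. $\mu$ is a Borel probability measure supported in $X$, absolutely continuous with respect to Lebesgue measure, with density $\rho$ that is $\alpha$-Hölder continuous, $\alpha\in(0,1]$. The cost satisfies: (Reg) $c(\cdot,y_i)\in C^2(X)$ for all $i$; (Twist) $\nabla_x c(x,y_i)\ne\nabla_x c(x,y_k)$ for all $x\in X$, $i\ne k$; (QC) for each $i$ there are a convex set $Y_i\subset\mathbb{R}^n$ and a $C^2$ diffeomorphism $\exp_i:Y_i\to X$ such that for all $t\in\mathbb{R}$ and $1\le k,i\le N$ the set $\{p\in Y_i: -c(\exp_i(p),y_k)+c(\exp_i(p),y_i)\le t\}$ is convex. $X$ is $c$-convex with respect to $Y$: $\exp_i^{-1}(X)$ is convex for every $i$. For $\psi\in\mathbb{R}^N$ (components are superscripts), $\operatorname{Lag}_i(\psi)=\{x\in X: c(x,y_i)+\psi^i=\min_j (c(x,y_j)+\psi^j)\}$, $G^i(\psi)=\mu(\operatorname{Lag}_i(\psi))$,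 $G=(G^1,\dots,G^N):\mathbb{R}^N\to\mathbb{R}^N$. Parameter shuffling routine. Input: tolerance $\epsilon\in(0,\frac1{3N})$ and $\psi_{in}\in\mathbb{R}^N$. Set $\psi:=\psi_{in}$. While $\min_jG^j(\psi)\le\epsilon$: for $i=1,\dots,N$ in order, if $G^i(\psi)\le\epsilon$ then find $r>0$ with $G^i(\psi-re^i)\in[2\epsilon,3\epsilon]$ ($e^i$ the $i$-th standard basis vector) and set $\psi:=\psi-re^i$. Return $\psi_{out}:=\psi$. A ''step'' is one execution of the update $\psi:=\psi-re^i$. *)

(* Defs.v *)
From HB Require Import structures.
From mathcomp Require Import all_boot all_order all_algebra.
From mathcomp Require Import all_classical all_reals all_analysis.
From mathcomp Require Import measurable_realfun.
Set Implicit Arguments.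
Unset Strict Implicit.
Unset Printing Implicit Defensive.
Import Order.TTheory GRing.Theory Num.Theory.
Import numFieldNormedType.Exports.
Local Open Scope classical_set_scope.
Local Open Scope ring_scope.

Definition rV_borel_display : measure_display.
Proof. exact: default_measure_display. Qed.

Section rV_borel.
Variables (R : realType) (n : nat).

Definition rV_borel : set (set 'rV[R]_n) := <<s @open 'rV[R]_n >>.

Let borel0 : rV_borel set0. Proof. exact: sigma_algebra0. Qed.
Let borelC A : rV_borel A -> rV_borel (~` A).
Proof. exact: sigma_algebraC. Qed.
Let borel_bigcup (F : (set 'rV[R]_n)^nat) :
  (forall i, rV_borel (F i)) -> rV_borel (\bigcup_i F i).
Proof. exact: sigma_algebra_bigcup. Qed.

HB.instance Definition _ := @isMeasurable.Build rV_borel_display 'rV[R]_n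
  rV_borel borel0 borelC borel_bigcup.
End rV_borel.

Section lebesgue_rV.
Variable R : realType.

Lemma measurable_fun_rV d (T : measurableType d) m (f : T -> 'rV[R]_m) :
  (forall j, measurable_fun setT (fun t => f t ord0 j)) ->
  measurable_fun setT f.
Proof.
move=> mf; apply: (@measurability _ _ _ _ _ _ (@open 'rV[R]_m)) => //.
move=> _ [U oU <-]; rewrite setTI.
pose cube (aq : 'rV[rat]_m * rat) :=
  [set t | forall j, `|ratr (aq.1 ord0 j) - f t ord0 j| < ratr aq.2 :> R].
pose inU (aq : 'rV[rat]_m * rat) := forall y : 'rV[R]_m,
  (forall j, `|ratr (aq.1 ord0 j) - y ord0 j| < ratr aq.2 :> R) -> U y.
have -> : f @^-1` U = \bigcup_aq (if `[<inU aq>] then cube aq else set0).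
  apply/seteqP; split=> [t Uft|t [aq _]]; last first.
    by case: asboolP => // aqU ?; exact: aqU.
  have /nbhs_ballP[e /= e0 eU] : nbhs (f t) U by exact: open_nbhs_nbhs.
  have e20 : 0 < e / 2 by rewrite divr_gt0.
  have [q] := @rat_in_itvoo R 0 (e / 2) e20.
  rewrite in_itv/= => /andP[q0 qe].
  have ex_a j : exists a : rat, `|ratr a - f t ord0 j| < ratr q :> R.
    have [|a] := @rat_in_itvoo R (f t ord0 j - ratr q) (f t ord0 j + ratr q).
      by rewrite ltrBlDr -addrA ltrDl addr_gt0.
    rewrite in_itv/= => /andP[a1 a2]; exists a.
    by rewrite ltr_norml ltrBlDl ltrBrDl a1 a2.
  pose a := \row_j projT1 (cid (ex_a j)).
  have aq_t j : `|ratr (a ord0 j) - f t ord0 j| < ratr q :> R.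
    by rewrite mxE; exact: projT2 (cid (ex_a j)).
  exists (a, q) => //; case: asboolP => //= -[] y ay; apply: eU; split=> // i j.
  rewrite ord1 /ball/= (le_lt_trans (ler_distD (ratr (a ord0 j)) _ _))//.
  by rewrite [e]splitr ltrD// ?(lt_trans _ qe)// 1?distrC ?(lt_trans (ay _)).
apply: countable_bigcupT_measurable => // aq.
case: asboolP => // _.
have -> : cube aq = \bigcap_(j in [set: 'I_m])
    (fun t => `|ratr (aq.1 ord0 j) - f t ord0 j|) @^-1` `]-oo, ratr aq.2[.
  by apply/seteqP; split=> t h j; [move=> _|]; have := h j; rewrite /= in_itv;
    [|apply].
apply: fin_bigcap_measurable; first exact: finite_finset.
move=> j _; rewrite -[X in measurable X]setTI.
suff : measurable_fun setT (fun t => `|ratr (aq.1 ord0 j) - f t ord0 j|).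
  by apply => //; exact: measurable_itv.
by apply: measurableT_comp => //; exact: measurable_funB.
Qed.

Lemma measurable_rV_coord m (j : 'I_m) :
  measurable_fun setT (fun v : 'rV[R]_m => v ord0 j).
Proof.
apply: (measurability _ (RGenOInfty.measurableE R)) => _ [_ [x ->] <-].
rewrite setTI; apply: sub_sigma_algebra.
by apply: open_comp => [v _|]; [exact: coord_continuous|exact: rray_open].
Qed.

Definition rV_cons m (xv : R * 'rV[R]_m) : 'rV[R]_m.+1 :=
  row_mx (xv.1)%:M xv.2.

Lemma rV_consE m x (v : 'rV[R]_m) (j : 'I_m.+1) :
  rV_cons (x, v) ord0 j = if unlift ord0 j is Some k then v ord0 k else x.
Proof.
rewrite /rV_cons/=; case: unliftP => [k ->|->].
  have -> : lift ord0 k = rshift 1 k by exact: val_inj.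
  exact: row_mxEr.
have -> : @ord0 m = lshift m (@ord0 0) by exact: val_inj.
by apply: etrans (row_mxEl _ _ _ _) _; rewrite mxE eqxx.
Qed.

Lemma measurable_rV_cons m : measurable_fun setT (@rV_cons m).
Proof.
apply: measurable_fun_rV => j.
under eq_fun do rewrite [X in rV_cons X]surjective_pairing rV_consE.
case: unliftP => [k _|_]; last exact: measurable_fst.
exact: measurableT_comp (measurable_rV_coord k) measurable_snd.
Qed.

Section lebesgue_cons.
Variables (m : nat) (mu : {sigma_finite_measure set 'rV[R]_m -> \bar R}).

Definition lebesgue_cons : set 'rV[R]_m.+1 -> \bar R :=
  pushforward (lebesgue_measure \x mu)%E (@rV_cons m).

Let pf : {measure set 'rV[R]_m.+1 -> \bar R} :=
  measure_function_pushforward__canonical__measure_function_Measure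
    (lebesgue_measure \x mu)%E (@measurable_rV_cons m).

HB.instance Definition _ := isMeasure.Build _ _ _ lebesgue_cons
  (measure0 pf) (measure_ge0 pf) (@measure_semi_sigma_additive _ _ _ pf).

Let lebesgue_cons_sigma_finite : sigma_finite setT lebesgue_cons.
Proof.
have /sigma_finiteP[F [TF ndF Foo]] := sigma_finiteT (@lebesgue_measure R).
have /sigma_finiteP[G [TG ndG Goo]] := sigma_finiteT mu.
pose uncons (v : 'rV[R]_m.+1) :=
  (v ord0 ord0, \row_(j < m) v ord0 (lift ord0 j)).
have consK : cancel (@rV_cons m) uncons.
  case=> x v; rewrite /uncons rV_consE unlift_none; congr pair.
  by apply/rowP => j; rewrite mxE rV_consE liftK.
have munc : measurable_fun setT uncons.
  apply: measurable_fun_pair; first exact: measurable_rV_coord.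
  apply: measurable_fun_rV => j; under eq_fun do rewrite mxE.
  exact: measurable_rV_coord.
exists (fun k => uncons @^-1` (F k `*` G k)).
  apply/esym; rewrite -subTset => v _.
  have : [set: R] (uncons v).1 by []. rewrite TF => -[i _ Fi].
  have : [set: 'rV[R]_m] (uncons v).2 by []. rewrite TG => -[j _ Gj].
  exists (maxn i j) => //; split.
  - by move: Fi; exact/subsetPset/ndF/leq_maxl.
  - by move: Gj; exact/subsetPset/ndG/leq_maxr.
move=> k; have [mF Fk] := Foo k; have [mG Gk] := Goo k; split.
  by rewrite -[X in measurable X]setTI; apply: munc => //; exact: measurableX.
rewrite /lebesgue_cons /pushforward -comp_preimage.
rewrite (_ : uncons \o _ = id); last exact/funext.
by rewrite preimage_id product_measure1E// lte_mul_pinfty// ge0_fin_numE.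
Qed.

HB.instance Definition _ := Measure_isSigmaFinite.Build _ _ _ lebesgue_cons
  lebesgue_cons_sigma_finite.
End lebesgue_cons.

(* See lebesgue_rV_box for its values on boxes, which characterize it. *)
Fixpoint lebesgue_rV m : {sigma_finite_measure set 'rV[R]_m -> \bar R} :=
  if m is m'.+1 then lebesgue_cons (lebesgue_rV m') else \d_(0 : 'rV[R]_0).

End lebesgue_rV.

Lemma lebesgue_rV_box (R : realType) m (a b : 'rV[R]_m) :
  (forall j, a ord0 j <= b ord0 j) ->
  lebesgue_rV R m [set v : 'rV[R]_m | forall j, a ord0 j <= v ord0 j <= b ord0 j]
  = (\prod_j (b ord0 j - a ord0 j))%:E.
Proof.
elim: m a b => [|m IH] a b ab.
  rewrite big_ord0 /= diracE (_ : _ \in _)//.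
  by rewrite inE => -[].
pose tl (u : 'rV[R]_m.+1) := \row_j u ord0 (lift ord0 j).
have mbox : measurable [set v : 'rV[R]_m |
    forall j, tl a ord0 j <= v ord0 j <= tl b ord0 j].
  rewrite [X in measurable X](_ : _ = \bigcap_(j in [set: 'I_m])
      (fun v : 'rV[R]_m => v ord0 j) @^-1` `[tl a ord0 j, tl b ord0 j]).
    apply: fin_bigcap_measurable => [|j _]; first exact: finite_finset.
    by rewrite -[X in measurable X]setTI; exact: measurable_rV_coord.
  by apply/seteqP; split=> v h j; [move=> _|]; have := h j;
    rewrite /= in_itv; [|apply].
rewrite /= /lebesgue_cons /pushforward.
rewrite [X in product_measure1 _ _ X](_ : _ = `[a ord0 ord0, b ord0 ord0]%classic `*`
    [set v : 'rV[R]_m | forall j, tl a ord0 j <= v ord0 j <= tl b ord0 j]).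
  rewrite product_measure1E// IH; last by move=> j; rewrite !mxE.
  rewrite [X in (X * _)%E](_ : _ = (b ord0 ord0 - a ord0 ord0)%:E).
    by rewrite -EFinM big_ord_recl; under eq_bigr do rewrite !mxE.
  apply: etrans (lebesgue_measure_itv _) _; rewrite /= lte_fin.
  case: ltP => [_|ba]; first by rewrite EFinB.
  have -> : b ord0 ord0 = a ord0 ord0 by apply/eqP; rewrite eq_le ba ab.
  by rewrite subrr.
apply/seteqP; split=> -[x v] /= h.
  split; first by have := h ord0; rewrite rV_consE unlift_none in_itv.
  by move=> j; have := h (lift ord0 j); rewrite rV_consE liftK !mxE.
case: h => [xab vab] j; rewrite rV_consE; case: unliftP => [k ->|->].
  by have := vab k; rewrite !mxE.
by move: xab; rewrite in_itv.
Qed.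

Section euclidean.
Variable R : realType.

(* The library norm on 'rV[R]_m is the maximum norm. *)
Definition enorm m (u : 'rV[R]_m) : R := Num.sqrt (\sum_j u ord0 j ^+ 2).

Definition holder_on m (alpha : R) (A : set 'rV[R]_m) (f : 'rV[R]_m -> R) :=
  exists C : R, forall x z, A x -> A z ->
    `|f x - f z| <= C * enorm (x - z) `^ alpha.

(* The least Lipschitz constant; +oo when the map is not Lipschitz. *)
Definition lipschitz_constant m p (F : 'rV[R]_m -> 'rV[R]_p) : \bar R :=
  ereal_inf [set K%:E | K in [set K : R | 0 <= K /\
    forall u v, enorm (F u - F v) <= K * enorm (u - v)]].

Definition grad m (f : 'rV[R]_m -> R) (x : 'rV[R]_m) : 'rV[R]_m :=
  \row_j 'D_(delta_mx ord0 j) f x.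

Fixpoint Ck_on_open m (V : normedModType R) (k : nat) (U : set 'rV[R]_m)
    (f : 'rV[R]_m -> V) : Prop :=
  if k is k'.+1 then forall j : 'I_m,
    (forall x, U x -> derivable f x (delta_mx ord0 j)) /\
    Ck_on_open k' U ('D_(delta_mx ord0 j) f)
  else forall x, U x -> {for x, continuous f}.

(* C^k on an arbitrary set is read as C^k on an open neighbourhood of it. *)
Definition Ck m (V : normedModType R) (k : nat) (A : set 'rV[R]_m)
    (f : 'rV[R]_m -> V) : Prop :=
  exists U : set 'rV[R]_m, [/\ open U, A `<=` U & Ck_on_open k U f].

Definition C2_diffeo m (A B : set 'rV[R]_m) (f : 'rV[R]_m -> 'rV[R]_m) : Prop :=
  [/\ set_bij A B f, Ck 2 A f &
      exists g, Ck 2 B g /\ {in A, cancel f g}].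

End euclidean.

Section optimal_transport.
Variables (R : realType) (n N : nat).
Variables (X : set 'rV[R]_n) (y : 'I_N -> 'rV[R]_n).
Variable c : 'rV[R]_n -> 'rV[R]_n -> R.

(* Only the restriction of c to X * range y is meaningful; outside X, c(., y_i)
   is a C^2 extension of it. *)
Definition Reg := forall i, Ck 2 X (fun x => c x (y i)).

Definition Twist := forall x i k, X x -> i <> k ->
  grad (fun z => c z (y i)) x <> grad (fun z => c z (y k)) x.

Definition QC (D : 'I_N -> set 'rV[R]_n)
    (ex : 'I_N -> 'rV[R]_n -> 'rV[R]_n) :=
  forall i, [/\ convex_set (D i), C2_diffeo (D i) X (ex i) &
    forall (t : R) k, convex_set
      [set p | D i p /\ - c (ex i p) (y k) + c (ex i p) (y i) <= t]].

Definition c_convex (D : 'I_N -> set 'rV[R]_n)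
    (ex : 'I_N -> 'rV[R]_n -> 'rV[R]_n) :=
  forall i, convex_set (D i `&` ex i @^-1` X).

Definition cost_norm : R := sup [set `|c x z| | x in X & z in range y].

Definition Lag (psi : 'rV[R]_N) (i : 'I_N) : set 'rV[R]_n :=
  [set x | X x /\
     forall j, c x (y i) + psi ord0 i <= c x (y j) + psi ord0 j].

Definition Gmap (mu : probability 'rV[R]_n R) (psi : 'rV[R]_N) : 'rV[R]_N :=
  \row_i fine (mu (Lag psi i)).

Definition supported_with_density (mu : probability 'rV[R]_n R)
    (rho : 'rV[R]_n -> R) :=
  [/\ mu (~` X) = 0%E, (forall x, X x -> 0 <= rho x) &
      forall A, measurable A -> A `<=` X ->
        mu A = (\int[lebesgue_rV R n]_(x in A) (rho x)%:E)%E].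

End optimal_transport.

Section parameter_shuffling.
Variables (R : realType) (N : nat) (G : 'rV[R]_N -> 'rV[R]_N) (eps : R).

(* (None, psi): about to test the while condition; (Some k, psi): inside the
   for loop, about to treat the index k, the for loop being over if k = N. *)
Definition shuffle_state : Type := (option nat * 'rV[R]_N)%type.

(* One transition of the routine, nondeterministic in the choice of r; the
   boolean tells whether it executes the update psi := psi - r e^i. *)
Inductive shuffle : bool -> shuffle_state -> shuffle_state -> Prop :=
| shuffle_enter psi :
    (exists j, G psi ord0 j <= eps) ->
    shuffle false (None, psi) (Some 0%N, psi)
| shuffle_update (i : 'I_N) psi r :
    G psi ord0 i <= eps -> 0 < r ->
    2 * eps <= G (psi - r *: delta_mx ord0 i) ord0 i <= 3 * eps ->
    shuffle true (Some (val i), psi)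
      (Some (val i).+1, psi - r *: delta_mx ord0 i)
| shuffle_skip (i : 'I_N) psi :
    eps < G psi ord0 i ->
    shuffle false (Some (val i), psi) (Some (val i).+1, psi)
| shuffle_next psi :
    shuffle false (Some N, psi) (None, psi).

(* shuffle_run k s s': an execution from s to s' with k updates. *)
Inductive shuffle_run : nat -> shuffle_state -> shuffle_state -> Prop :=
| shuffle_run0 s : shuffle_run 0 s s
| shuffle_runS k b s s' s'' :
    shuffle_run k s s' -> shuffle b s' s'' -> shuffle_run (b + k) s s''.

Definition shuffle_returns (s : shuffle_state) :=
  s.1 = None /\ forall j, eps < G s.2 ord0 j.

(* Every execution from psi_in can be continued until the routine returns (in
   particular a suitable r always exists), is finite, and makes at most B
   updates. *)
Definition shuffle_terminates_in (psi_in : 'rV[R]_N) (B : \bar R) :=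
  let init := (None, psi_in) : shuffle_state in
  [/\ forall k s, shuffle_run k init s ->
        shuffle_returns s \/ exists b s', shuffle b s s',
      forall u : nat -> shuffle_state, u 0%N = init ->
        ~ (forall m, exists b, shuffle b (u m) (u m.+1)) &
      forall k s, shuffle_run k init s -> ((k%:R)%:E <= B)%E].

End parameter_shuffling.

(* Main.v *)
Require Import Defs.
From HB Require Import structures.
From mathcomp Require Import all_boot all_order all_algebra.
From mathcomp Require Import finmap.
From mathcomp Require Import all_classical all_reals all_analysis.
From mathcomp Require Import measurable_realfun.
From mathcomp Require Import ring lra.
Import Order.TTheory GRing.Theory Num.Theory.
Import numFieldNormedType.Exports.
Local Open Scope classical_set_scope.
Local Open Scope ring_scope.
Set Implicit Arguments.
Unset Strict Implicit.
Unset Printing Implicit Defensive.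

(* The cells always cover [X], so some [G^j] is at least [1/N > 3 eps]; as
   an updated index keeps [G^i <= 3 eps], some index [j] is never updated and
   [psi^j] stays at its initial value. As long as a cell [i] has positive mass
   it is nonempty, whence [psi^i - psi^k <= 2 |c|] for all [k]. So after its
   first update [psi^i] lies below [psi_in^j + 2 |c|], and it never falls below
   [psi_in^j - 2 |c|]. An update raises [G^i] by at least [eps], hence has
   length at least [eps / L]: each of the at most [N - 1] updated indices is
   updated at most [4 L |c| / eps + 1] times.
   The steps exist, and the routine stops even when [L] is infinite, because
   [G] is uniformly continuous along the coordinate directions: by (Twist) the
   level sets of [c(., y_i) - c(., y_k)] are locally graphs over a coordinate
   hyperplane, hence null by Fubini, and compactness makes the mass of thin
   slabs around them uniformly small. This gives a positive lower bound on the
   length of a step that can be used in place of [eps / L]. *)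

(** * Counting the steps of the routine *)

Section shuffle_count.
Variables (R : realType) (N : nat) (G : 'rV[R]_N -> 'rV[R]_N) (eps : R).
Implicit Types (psi : 'rV[R]_N) (i j : 'I_N) (k : nat) (s : shuffle_state R N).

Lemma shift_coord psi r i j :
  (psi - r *: delta_mx ord0 i) ord0 j = psi ord0 j - r * (j == i)%:R.
Proof. by rewrite !mxE eqxx. Qed.

Lemma shift_coord_neq psi r i j :
  j != i -> (psi - r *: delta_mx ord0 i) ord0 j = psi ord0 j.
Proof. by rewrite shift_coord => /negPf ->; rewrite mulr0 subr0. Qed.

Hypothesis eps_gt0 : 0 < eps.
Hypothesis G_dominant : forall psi, exists j, 3 * eps < G psi ord0 j.
Hypothesis G_shift_neq : forall psi (r : R) i j, 0 <= r -> j != i ->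
  G (psi - r *: delta_mx ord0 i) ord0 j <= G psi ord0 j.
Variable C : R.
Hypothesis G_pos_gap : forall psi i j,
  0 < G psi ord0 i -> psi ord0 i - psi ord0 j <= 2 * C.
Hypothesis C_ge0 : 0 <= C.

(** * Counting updates when every step has length at least [delta] *)

Section step_length.
Variable delta : R.
Hypothesis delta_gt0 : 0 < delta.
Hypothesis G_step : forall psi (r : R) i, G psi ord0 i <= eps -> 0 < r ->
  2 * eps <= G (psi - r *: delta_mx ord0 i) ord0 i -> delta <= r.

(* [cnt i] is the number of updates of the index [i] so far. The first one
   brings [psi^i] down to at most [psi_in^j + 2 C] for every index [j] that is
   never updated, and each further one lowers it by at least [delta]. *)
Lemma shuffle_run_cnt psi_in k s :
  shuffle_run G eps k (None, psi_in) s ->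
  exists2 cnt : 'I_N -> nat, (\sum_i cnt i)%N = k &
    forall i, if cnt i is m.+1 then
        G s.2 ord0 i <= 3 * eps /\
        forall j, cnt j = 0%N -> m%:R * delta + s.2 ord0 i <= psi_in ord0 j + 2 * C
      else s.2 ord0 i = psi_in ord0 i.
Proof.
move=> run; have [s0 s0E] : exists s0 : shuffle_state R N, s0 = (None, psi_in).
  by eexists.
rewrite -s0E in run; elim: run s0E => {k s s0}[_ ->|k b s0 s s' _ IH st s0E].
  by exists (fun=> 0%N) => //; rewrite big1.
have [cnt cntk cntP] := IH s0E; case: st cntP => {s s' IH s0E} /=.
- by move=> psi _ cntP; exists cnt.
- move=> i psi r Gi r0 /andP[Gi1 Gi2] cntP.
  exists (fun j => (i == j) + cnt j)%N.
    rewrite big_split/= cntk (bigD1 i)//= eqxx big1 ?addn0// => j.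
    by rewrite eq_sym => /negPf ->.
  have Gi0 : 0 < G (psi - r *: delta_mx ord0 i) ord0 i.
    by apply: lt_le_trans Gi1; rewrite mulr_gt0.
  move=> l; have [<-{l}|il] := eqVneq i l; last first.
    rewrite add0n; have := cntP l; case: (cnt l) => [|m].
      by rewrite shift_coord_neq// eq_sym.
    (* An update of [i] cannot raise [G] at [l], so the bound [3 * eps] survives there. *)
    move=> [Gl lP]; split.
      by rewrite (le_trans _ Gl)// G_shift_neq ?ltW// eq_sym.
    move=> j /eqP; rewrite addn_eq0 => /andP[_ /eqP/lP].
    by rewrite shift_coord_neq// eq_sym.
  rewrite add1n; split=> // j /eqP; rewrite addn_eq0 eqb0 => /andP[ij /eqP cj].
  have := cntP i; case: (cnt i) => [_|m [_ /(_ j cj)]].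
    rewrite mul0r add0r.
    have := @G_pos_gap _ i j Gi0; rewrite [in X in _ - X]shift_coord_neq 1?eq_sym//.
    by have := cntP j; rewrite cj => -> /=; lra.
  rewrite shift_coord eqxx mulr1 -natr1.
  by have := G_step Gi r0 Gi1; lra.
- by move=> i psi _ cntP; exists cnt.
- by move=> psi cntP; exists cnt.
Qed.

(** An index [j] with [G^j > 3 * eps] was never updated, and its positive mass gives
    [psi^j <= psi^i + 2 * C]. Against the upper bound left by the first update of [i], this leaves
    room [4 * C] for its later steps. Since [j] itself counts 0, only [N - 1] indices contribute. *)
Lemma shuffle_run_bound psi_in k s :
  shuffle_run G eps k (None, psi_in) s ->
  k%:R <= (N%:R - 1) * (4 * C / delta + 1) :> R.
Proof.
move=> /shuffle_run_cnt[cnt <- cntP].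
have [j Gj] := G_dominant s.2.
have cj : cnt j = 0%N.
  by have := cntP j; case: (cnt j) => // m [+ _]; rewrite leNgt Gj.
have psij : s.2 ord0 j = psi_in ord0 j by have := cntP j; rewrite cj.
have cntB i : (cnt i)%:R <= 4 * C / delta + 1.
  have := cntP i; case: (cnt i) => [_|m [_ /(_ j cj) mP]].
    by rewrite addr_ge0// divr_ge0 ?mulr_ge0// ltW.
  rewrite -natr1 lerD2r ler_pdivlMr//.
  have /(@G_pos_gap _ j i) : 0 < G s.2 ord0 j by rewrite (lt_trans _ Gj)// mulr_gt0.
  by rewrite psij; lra.
rewrite (bigD1 j)//= cj add0n natr_sum (le_trans (ler_sum _ (fun i _ => cntB i)))//.
rewrite sumr_const cardC1 card_ord -[leLHS]mulr_natl -subn1 natrB//.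
by case: (N) j {Gj cj psij} => [[]|].
Qed.

End step_length.

(* A pass of the for loop consists of [N + 2] transitions and contains at least
   one update. *)
Lemma shuffle_path_run psi_in (u : nat -> shuffle_state R N) :
  u 0%N = (None, psi_in) ->
  (forall m, exists b, shuffle G eps b (u m) (u m.+1)) ->
  forall m, exists k, shuffle_run G eps k (None, psi_in) (u m) /\
    (m <= k.+1 * N.+2)%N.
Proof.
move=> u0 us m.
(* Here [p] counts the completed passes. Inside a pass, either the updates already outnumber the
   completed passes, or an index with [G^j <= eps] is still ahead; at [q = N] only the former is
   possible. *)
suff [k [p [runk mE pP]]] : exists k p, [/\ shuffle_run G eps k (None, psi_in) (u m),
    m = (p * N.+2 + if (u m).1 is Some q then q.+1 else 0)%N &
    if (u m).1 is Some q then (q <= N)%N /\ ((p < k)%N \/ (p <= k)%N /\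
      exists2 j : 'I_N, (q <= j)%N & G (u m).2 ord0 j <= eps) else (p <= k)%N].
  exists k; split=> //; rewrite {}mE; case: (u m).1 pP => [q [qN pk]|pk].
    have {}pk : (p <= k)%N by case: pk => [/ltnW|[]].
    by rewrite mulSn [leqLHS]addnC leq_add ?leq_mul2r ?pk ?orbT// ltnS leqW.
  by rewrite addn0 leq_mul2r leqW// orbT.
elim: m => [|m [k [p [runk mE pP]]]].
  by exists 0%N, 0%N; rewrite u0; split=> //; exact: shuffle_run0.
have [b st] := us m; have := shuffle_runS runk st.
move: (u m) (u m.+1) st mE pP => _ _ [psi [j Gj]|i psi r Gi r0 _|i psi Gi|psi] /=.
- rewrite addn0 add0n => -> pk run; exists k, p; split=> //; first by rewrite addn1.
  by split=> //; right; split=> //; exists j.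
- move=> -> [iN pk] run; exists k.+1, p; split=> //; first by rewrite [RHS]addnS.
  by split=> //; left; case: pk => [/ltnW|[]]; rewrite ltnS.
- move=> -> [iN pk] run; exists k, p; split=> //; first by rewrite [RHS]addnS.
  split=> //; case: pk => [|[pk [j ij Gj]]]; [by left|right; split=> //].
  exists j => //; rewrite ltn_neqAle ij andbT; apply: contraTneq Gj => ij'.
  by rewrite -ltNge (_ : j = i)//; exact: val_inj.
- move=> -> [_ [pk|[_ [j Nj _]]]] run;
    last by have := ltn_ord j; rewrite ltnNge Nj.
  by exists k, p.+1; split=> //; rewrite addn0 -addnS mulSn addnC.
Qed.

Lemma shuffle_run_index psi_in k s : shuffle_run G eps k (None, psi_in) s ->
  if s.1 is Some q then (q <= N)%N else true.
Proof.
have [s0 s0E] : exists s0 : shuffle_state R N, s0 = (None, psi_in).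
  by eexists.
rewrite -s0E => run; elim: run s0E => {k s s0}[_ ->//|k b s0 s s' _ IH st s0E].
by case: st (IH s0E) => //= *; exact: ltn_ord.
Qed.

(** [B] is kept apart from [delta]: any positive step length, however crude, excludes infinite
    executions, while the sharp bound is supplied separately. *)
Lemma shuffle_terminates (delta : R) psi_in (B : \bar R) :
  0 < delta ->
  (forall psi (r : R) i, G psi ord0 i <= eps -> 0 < r ->
    2 * eps <= G (psi - r *: delta_mx ord0 i) ord0 i -> delta <= r) ->
  (forall psi i, G psi ord0 i <= eps -> exists2 r : R, 0 < r &
    2 * eps <= G (psi - r *: delta_mx ord0 i) ord0 i <= 3 * eps) ->
  (forall k s, shuffle_run G eps k (None, psi_in) s -> ((k%:R)%:E <= B)%E) ->
  shuffle_terminates_in G eps psi_in B.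
Proof.
move=> delta0 stepG updG runB; split=> // [k [[q|] psi] run|u u0 us].
- have := shuffle_run_index run; rewrite /= leq_eqVlt => /predU1P[->|qN].
    by right; exists false, (None, psi); exact: shuffle_next.
  right; have [Gq|Gq] := leP (G psi ord0 (Ordinal qN)) eps.
    have [r r0 Gr] := updG _ _ Gq.
    exists true, (Some q.+1, psi - r *: delta_mx ord0 (Ordinal qN)).
    exact: (@shuffle_update _ _ _ _ (Ordinal qN)).
  exists false, (Some q.+1, psi).
  exact: (@shuffle_skip _ _ _ _ (Ordinal qN)).
- have [[j Gj]|nG] := pselect (exists j, G psi ord0 j <= eps).
    by right; exists false, (Some 0%N, psi); apply: shuffle_enter; exists j.
  by left; split=> // j; rewrite ltNge; apply/negP => Gj; apply: nG; exists j.
(* [M] exceeds the bound on the number of updates, so more than [M * N.+2] transitions are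
   impossible. *)
pose M := (Num.truncn ((N%:R - 1) * (4 * C / delta + 1) : R)).+1.
have [k [/(shuffle_run_bound delta0 stepG) kM]] :=
  shuffle_path_run u0 us (M * N.+2).+1.
apply/negP; rewrite -ltnNge ltnS leq_mul2r/=.
by rewrite -(ltr_nat R) (le_lt_trans kM)// truncnS_gt.
Qed.

End shuffle_count.

(** * Functions with continuous partial derivatives *)

Section partial_derivatives.
Variables (R : realType) (n : nat).
Implicit Types (f : 'rV[R]_n -> R) (p v x z : 'rV[R]_n) (U : set 'rV[R]_n).

Local Notation e_ j := (delta_mx ord0 j : 'rV[R]_n).

Definition box x (r : R) : set 'rV[R]_n :=
  [set z | forall j, `|x ord0 j - z ord0 j| < r].

Lemma box_ball x r : 0 < r -> box x r = ball x r.
Proof.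
move=> r0; apply/seteqP; split=> [z xz|z [_ xz] j]; last exact: xz.
by split=> // i j; rewrite ord1; exact: xz.
Qed.

Lemma open_box x r : 0 < r -> open (box x r).
Proof. by move=> r0; rewrite box_ball//; exact: ball_open. Qed.

Lemma box_center x r : 0 < r -> box x r x.
Proof. by move=> r0 j; rewrite subrr normr0. Qed.

Lemma nbhs_box x (A : set 'rV[R]_n) :
  nbhs x A -> exists2 r, 0 < r & box x r `<=` A.
Proof.
by move=> /nbhs_ballP[r /= r0 rA]; exists r => //; rewrite box_ball.
Qed.

Lemma line_is_derive f p v (s : R) : derivable f (p + s *: v) v ->
  is_derive s 1 (fun h : R => f (p + h *: v)) ('D_v f (p + s *: v)).
Proof.
have E : (fun h : R => h^-1 *: (((fun h => f (p + h *: v)) \o shift s) (h *: 1)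
      - f (p + s *: v))) =
    (fun h => h^-1 *: ((f \o shift (p + s *: v)) (h *: v) - f (p + s *: v))).
  apply/funext => h /=; congr (_ *: (f _ - _)).
  by rewrite scalerDl [h *: 1]mulr1 addrCA.
by move=> df; split; rewrite ?/derivable ?/derive E.
Qed.

Lemma line_MVT f p v (a b : R) : a < b ->
  (forall s, a <= s <= b -> derivable f (p + s *: v) v) ->
  exists2 s, a < s < b &
    f (p + b *: v) - f (p + a *: v) = 'D_v f (p + s *: v) * (b - a).
Proof.
move=> ab df.
have drv s : a <= s <= b ->
    is_derive s 1 (fun h : R => f (p + h *: v)) ('D_v f (p + s *: v)).
  by move=> /df; exact: line_is_derive.
have [||s sab E] := @MVT R (fun h => f (p + h *: v))
    (fun s => 'D_v f (p + s *: v)) a b ab.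
- by move=> s /[!in_itv]/= /andP[sa sb]; apply: drv; rewrite !ltW.
- apply: derivable_within_continuous => s /[!in_itv]/= sab.
  by have [] := drv s sab.
- by exists s.
Qed.

Lemma line_increment f p (j : 'I_n) (s B : R) :
  (forall h, `|h| <= `|s| -> derivable f (p + h *: e_ j) (e_ j)) ->
  (forall h, `|h| <= `|s| -> `|'D_(e_ j) f (p + h *: e_ j)| <= B) ->
  `|f (p + s *: e_ j) - f p| <= B * `|s|.
Proof.
move=> df dfB; have [s0|s0|->] := ltgtP s 0; last first.
- by rewrite scale0r addr0 subrr !normr0 mulr0.
- have [|h /andP[h0 hs]] := @line_MVT f p (e_ j) 0 s s0.
    by move=> h /andP[h0 hs]; apply: df; rewrite !ger0_norm// ltW.
  rewrite scale0r addr0 subr0 => ->; rewrite normrM ler_wpM2r//.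
  by apply: dfB; rewrite !ger0_norm ?ltW.
- have [|h /andP[hs h0]] := @line_MVT f p (e_ j) s 0 s0.
    by move=> h /andP[hs h0]; apply: df; rewrite !ler0_norm ?lerN2// ltW.
  rewrite scale0r addr0 sub0r distrC => ->; rewrite normrM normrN ler_wpM2r//.
  by apply: dfB; rewrite !ler0_norm ?lerN2 ?ltW.
Qed.

(** Continuous partial derivatives are bounded near [x]. Moving from [x] to [z] one coordinate at a
    time, the mean value theorem turns these bounds into a Lipschitz estimate at [x]. *)
Lemma Ck_on_open1_continuous U f x :
  open U -> Ck_on_open 1 U f -> U x -> {for x, continuous f}.
Proof.
move=> oU CU Ux.
have near_x : \forall z \near x, U z /\
    forall j, `|'D_(e_ j) f z| <= `|'D_(e_ j) f x| + 1.
  apply: filterI; first exact: open_nbhs_nbhs.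
  apply: (@filter_forall _ _ _ _ (nbhs_filter x)) => j.
  have /cvg_norm/cvgrPdist_lt/(_ 1 ltr01) := (CU j).2 x Ux.
  apply: filterS => z; rewrite distrC => zx.
  by rewrite -lerBlDl (le_trans (ler_norm _))// ltW.
have [r r0 rP] := nbhs_box near_x.
have lip z : box x r z -> `|f z - f x| <=
    \sum_j (`|'D_(e_ j) f x| + 1) * `|z ord0 j - x ord0 j|.
  (* [p k] takes its first [k] coordinates from [z] and the others from [x], so consecutive points
     differ in one coordinate only. *)
  move=> xz; pose p k : 'rV[R]_n :=
    \row_j if (j < k)%N then z ord0 j else x ord0 j.
  have -> : f z - f x = \sum_(j < n) (f (p j.+1) - f (p j)).
    rewrite -(big_mkord xpredT (fun k => f (p k.+1) - f (p k))).
    rewrite telescope_sumr//; congr (f _ - f _); apply/rowP => j.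
      by rewrite mxE ltn_ord.
    by rewrite mxE ltn0.
  apply: le_trans (ler_norm_sum _ _ _) _; apply: ler_sum => j _.
  have -> : p j.+1 = p j + (z ord0 j - x ord0 j) *: e_ j.
    apply/rowP => i; rewrite !mxE eqxx/= ltnS leq_eqVlt.
    have [->|ij] := eqVneq i j; first by rewrite eqxx ltnn mulr1 addrC subrK.
    by rewrite (negPf (_ : val i != val j))// mulr0 addr0.
  have seg h : `|h| <= `|z ord0 j - x ord0 j| -> box x r (p j + h *: e_ j).
    move=> hs i; rewrite !mxE eqxx/=.
    have [->|ij] := eqVneq i j.
      rewrite ltnn mulr1 opprD addrA subrr sub0r normrN (le_lt_trans hs)//.
      by rewrite distrC; exact: xz.
    rewrite mulr0 addr0; case: ifP => _; first exact: xz.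
    by rewrite subrr normr0.
  by apply: line_increment => h /seg/rP[Uh dh]; [exact: (CU j).1|exact: dh].
apply/(@cvgrPdist_le _ _ _ _ (nbhs_filter x)) => e e0.
pose B := \sum_j (`|'D_(e_ j) f x| + 1).
have B0 : 0 <= B by apply: sumr_ge0 => j _; rewrite addr_ge0.
have B1 : 0 < B + 1 by rewrite ltr_wpDl.
(* [B] is an empty sum when [n = 0]; [B + 1] is always positive. *)
pose r' := Num.min r (e / (B + 1)).
have r'0 : 0 < r' by rewrite lt_min r0 divr_gt0.
have xbox : nbhs x (box x r') by rewrite box_ball//; exact: nbhsx_ballx.
apply: (@filterS _ _ (nbhs_filter x) _ _ _ xbox) => z xz; rewrite distrC.
apply: le_trans (lip z _) _.
  by move=> j; rewrite (lt_le_trans (xz j))// /r' ge_min lexx.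
have -> : e = (B + 1) * (e / (B + 1)) by rewrite mulrC divfK// gt_eqF.
apply: (@le_trans _ _ (B * r')); last first.
  by apply: ler_pM => //; rewrite ?lerDl// ?(ltW r'0)// /r' ge_min lexx orbT.
rewrite /B mulr_suml; apply: ler_sum => j _.
by rewrite ler_wpM2l ?addr_ge0// distrC ltW.
Qed.

Lemma Ck_on_open2_1 U f : open U -> Ck_on_open 2 U f -> Ck_on_open 1 U f.
Proof.
move=> oU C2 j; split; first exact: (C2 j).1.
by move=> x Ux; apply: Ck_on_open1_continuous Ux => //; exact: (C2 j).2.
Qed.

Lemma Ck_on_openB U f g : open U -> Ck_on_open 1 U f -> Ck_on_open 1 U g ->
  Ck_on_open 1 U (f \- g) /\
  forall x j, U x -> 'D_(e_ j) (f \- g) x = 'D_(e_ j) f x - 'D_(e_ j) g x.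
Proof.
move=> oU Cf Cg.
have DB x j : U x -> 'D_(e_ j) (f \- g) x = 'D_(e_ j) f x - 'D_(e_ j) g x.
  by move=> Ux; apply: deriveB; [exact: (Cf j).1|exact: (Cg j).1].
split; last exact: DB.
move=> j; apply: conj => x Ux.
  by apply: derivableB; [exact: (Cf j).1|exact: (Cg j).1].
(* The formula for the derivative of the difference holds only on [U]; as [U] is open, it holds near
   [x], which is enough for continuity. *)
rewrite /= /prop_for /continuous_at DB//.
apply: cvg_trans (cvgB ((Cf j).2 x Ux) ((Cg j).2 x Ux)).
apply: (@near_eq_cvg _ _ _ (nbhs_filter x)).
apply: (@filterS _ _ (nbhs_filter x) U) => [z Uz|]; first by rewrite DB.
exact: open_nbhs_nbhs.
Qed.

Lemma Ck_on_openS k U U' f : U' `<=` U -> Ck_on_open k U f -> Ck_on_open k U' f.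
Proof.
move=> UU'; elim: k f => [|k IH] f /= CU; first by move=> x /UU'/CU.
by move=> j; split=> [x /UU'/(CU j).1//|]; apply: IH; exact: (CU j).2.
Qed.

(* Rolle on the line through two points of the box. *)
Lemma box_level_line_inj f x r j (s : R) p : 0 < r ->
  (forall z, box x r z -> derivable f z (e_ j) /\ 'D_(e_ j) f z != 0) ->
  box x r p -> box x r (p + s *: e_ j) -> f p = f (p + s *: e_ j) -> s = 0.
Proof.
move=> r0 df.
have main q h : 0 < h -> box x r q -> box x r (q + h *: e_ j) ->
    f q = f (q + h *: e_ j) -> False.
  move=> h0 xq xqh fE.
  have seg s' : 0 <= s' <= h -> box x r (q + s' *: e_ j).
    move=> /andP[s0 sh] i; have := xq i; have := xqh i.
    rewrite !mxE eqxx/=; have [->|ij] := eqVneq i j; last by rewrite !mulr0 addr0.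
    by rewrite !mulr1 !ltr_norml; move=> /andP[? ?] /andP[? ?]; apply/andP; lra.
  have [|s' /andP[s0 sh]] := @line_MVT f q (e_ j) 0 h h0.
    by move=> s' /seg/df[].
  rewrite scale0r addr0 -fE subrr subr0 => /esym/eqP.
  rewrite mulf_eq0 (gt_eqF h0) orbF; apply/negP.
  by have [|_ ->] := df (q + s' *: e_ j); first by apply: seg; rewrite !ltW.
move=> xp xps fE; have [s0|s0|//] := ltgtP s 0; exfalso.
  apply: (main (p + s *: e_ j) (- s)); rewrite ?oppr_gt0// -addrA -scalerDl subrr.
  - by rewrite scale0r addr0.
  - by rewrite scale0r addr0.
exact: (main p s).
Qed.

End partial_derivatives.

(** * Level sets are null *)

Section level_sets.
Variable R : realType.
Local Open Scope ereal_scope.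

Lemma rV_cons_shift m (x : R) (v : 'rV[R]_m) (s : R) (j : 'I_m.+1) :
  (rV_cons (x, v) + s *: delta_mx ord0 j)%R =
  if unlift ord0 j is Some k then rV_cons (x, v + s *: delta_mx ord0 k)%R
  else rV_cons (x + s, v)%R.
Proof.
apply/rowP => i; rewrite mxE rV_consE [X in (_ + X)%R]mxE [X in (_ * X)%R]mxE eqxx/=.
case: (unliftP ord0 j) => [k ->|->]; rewrite rV_consE.
  case: (unliftP ord0 i) => [i' ->|->]; last by rewrite mulr0 addr0.
  by rewrite !mxE eqxx (inj_eq (@lift_inj _ _)).
case: (unliftP ord0 i) => [i' ->|->]; last by rewrite mulr1.
by rewrite mulr0 addr0.
Qed.

(* Fubini in the coordinate [j]. *)
Lemma lebesgue_rV_graph m (A : set 'rV[R]_m) (j : 'I_m) : measurable A ->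
  (forall p (s : R), A p -> A (p + s *: delta_mx ord0 j)%R -> s = 0%R) ->
  lebesgue_rV R m A = 0.
Proof.
elim: m A j => [A []//|m IH A j mA Aj].
rewrite /= /lebesgue_cons /pushforward.
set B := _ @^-1` A.
have mB : measurable B.
  by rewrite -[B]setTI; exact: (measurable_rV_cons (R := R)).
case: (unliftP ord0 j) => [k jk|j0].
  (* Fixing the first coordinate leaves a set with the same property in direction [k]. *)
  apply: integral0_eq => x _ /=; apply: (IH _ k); first exact: measurable_xsection.
  move=> p s; rewrite /xsection /= !inE /B /= => Ap Aps; apply: (Aj _ _ Ap).
  by rewrite rV_cons_shift jk liftK.
(* When [j] is the first coordinate, the order of integration is swapped: sections in that
   coordinate have at most one point. *)
rewrite (@product_measure_unique _ _ _ _ _ _ _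
  (@lebesgue_measure R \x^ lebesgue_rV R m))//; last first.
  by move=> A1 A2 mA1 mA2; exact: product_measure2E.
apply: integral0_eq => v _ /=.
have [->|/set0P[x Bx]] := eqVneq (ysection B v) set0; first by rewrite measure0.
rewrite (_ : ysection B v = [set x]) ?lebesgue_measure_set1//.
apply/seteqP; split=> [x'|_ ->//]; move: Bx; rewrite /ysection /= !inE /B /=.
move=> Ax Ax'; apply/eqP; rewrite -subr_eq0; apply/eqP/(Aj _ _ Ax).
by rewrite rV_cons_shift j0 unlift_none addrCA subrr addr0.
Qed.

Variable n : nat.
Implicit Types (X U : set 'rV[R]_n).

Lemma closed_measurable_rV X : closed X -> measurable X.
Proof.
move=> cX; rewrite -[X]setCK; apply: measurableC.
by apply: sub_sigma_algebra; exact: closed_openC.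
Qed.

Lemma closed_within_preimage X (f : 'rV[R]_n -> R) (B : set R) :
  closed X -> closed B -> (forall x, X x -> {for x, continuous f}) ->
  closed (X `&` f @^-1` B).
Proof.
move=> cX cB cf; have : {within X, continuous f}.
  by apply: continuous_in_subspaceT => x /[!inE] /cf.
by move=> /continuous_closedP/(_ _ cB); rewrite -(closed_setIS _ cX) setIC.
Qed.

(** Around each point of [X] some partial derivative is nonzero on a whole box. By Rolle, lines in
    that direction meet the level set at most once inside the box, so this piece is null; finitely
    many boxes cover the compact level set. *)
Lemma level_set_lebesgue0 X U (f : 'rV[R]_n -> R) (t : R) :
  compact X -> open U -> X `<=` U -> Ck_on_open 1 U f ->
  (forall x, X x -> exists j, 'D_(delta_mx ord0 j) f x != 0%R) ->
  lebesgue_rV R n (X `&` f @^-1` [set t]) = 0.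
Proof.
move=> cX oU XU C1 df; set Z := X `&` _.
have clX : closed X by apply: compact_closed => //; exact: norm_hausdorff.
have clZ : closed Z.
  apply: closed_within_preimage => // x /XU.
  exact: Ck_on_open1_continuous.
have /choice[r rP] : forall x, exists r : R, X x -> (0 < r)%R /\ exists j,
    forall z, box x r z ->
      derivable f z (delta_mx ord0 j) /\ 'D_(delta_mx ord0 j) f z != 0%R.
  move=> x; have [Xx|//] := pselect (X x); last by exists 0%R.
  have [j dfx] := df x Xx.
  have near_x : nbhs x (U `&` [set z | 'D_(delta_mx ord0 j) f z != 0%R]).
    apply: filterI; first by apply: open_nbhs_nbhs; split=> //; exact: XU.
    have /cvgrPdist_lt := (C1 j).2 x (XU _ Xx).
    move=> /(_ `|'D_(delta_mx ord0 j) f x|%R); rewrite normr_gt0 => /(_ dfx).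
    apply: (@filterS _ _ (nbhs_filter x)) => z; apply: contraTneq => ->.
    by rewrite subr0 ltxx.
  have [r r0 rU] := nbhs_box near_x; exists r => _; split=> //; exists j => z.
  by move=> /rU[Uz ?]; split=> //; exact: (C1 j).1.
have : compact Z by apply: (subclosed_compact clZ cX) => x [].
rewrite compact_cover => /(_ _ Z (fun x => box x (r x)))[x [/rP[r0 _] _]||D' D'Z ZD'].
- exact: open_box.
- by move=> x Zx; exists x => //; apply: box_center; case: Zx => /rP[].
have mZ := closed_measurable_rV clZ.
have mbox x : x \in D' -> measurable (box x (r x)).
  move=> /D'Z; rewrite inE => -[/rP[r0 _] _].
  by apply: sub_sigma_algebra; exact: open_box.
apply/eqP; rewrite -measure_le0.
apply: le_trans (content_sub_fsum (lebesgue_rV R n) (D := [set` D'])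
  (A_ := fun x => Z `&` box x (r x)) _ _ _ _) _ => //.
- by move=> x /mbox; exact: measurableI.
- by move=> x Zx; have [i ? ?] := ZD' x Zx; exists i.
rewrite fsbig1// => x /= xD'; have := D'Z _ xD'; rewrite inE => -[Xx _].
have [r0 [j dfj]] := rP x Xx.
apply: (lebesgue_rV_graph (j := j)); first by apply: measurableI => //; exact: mbox.
move=> p s [[_ /= fp] xp] [[_ /= fps] xps].
by apply: (box_level_line_inj r0 dfj xp xps); rewrite fp fps.
Qed.

End level_sets.

(** * Laguerre cells *)

Section laguerre.
Variables (R : realType) (n N : nat) (X : set 'rV[R]_n) (y : 'I_N -> 'rV[R]_n).
Variables (c : 'rV[R]_n -> 'rV[R]_n -> R) (mu : probability 'rV[R]_n R).
Hypothesis X_compact : compact X.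
Hypothesis N_gt0 : (0 < N)%N.
Hypothesis muXC : mu (~` X) = 0%E.
Hypothesis c_continuous :
  forall i x, X x -> {for x, continuous (fun z => c z (y i))}.
Implicit Types (i j k : 'I_N) (psi : 'rV[R]_N).

Let d i k x := c x (y i) - c x (y k).
Let C := cost_norm X y c.
Let G := Gmap X y c mu.

(** With [t = psi^k - psi^i], this contains whatever a shift of length at most [delta] can move
    across the interface between the cells [i] and [k]. *)
Definition slab i k (t delta : R) : set 'rV[R]_n :=
  X `&` [set x | `|t - d i k x| <= delta].

Lemma closed_X : closed X.
Proof. by apply: compact_closed => //; exact: norm_hausdorff. Qed.

Lemma measurable_X : measurable X.
Proof. by apply: closed_measurable_rV; exact: closed_X. Qed.

Lemma measurable_cost_diff i k (B : set R) : closed B ->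
  measurable (X `&` d i k @^-1` B).
Proof.
move=> cB; apply: closed_measurable_rV.
apply: closed_within_preimage => //; first exact: closed_X.
by move=> x Xx; exact: (cvgB (@c_continuous i x Xx) (@c_continuous k x Xx)).
Qed.

Lemma measurable_slab i k t delta : measurable (slab i k t delta).
Proof.
rewrite (_ : slab _ _ _ _ = X `&` d i k @^-1` `[t - delta, t + delta]).
  by apply: measurable_cost_diff; exact: itv_closed.
by apply/seteqP; rewrite /slab; split=> x [Xx] /=; rewrite in_itv/= ler_distlC.
Qed.

Lemma mu_X1 : mu X = 1%E.
Proof.
have := probability_setC mu (measurableC measurable_X).
by rewrite setCK muXC sube0.
Qed.

Lemma cost_le_norm i x : X x -> `|c x (y i)| <= C.
Proof.
move=> Xx; apply: ub_le_sup; last by exists x => //; exists (y i) => //; exists i.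
(* [sup] is an upper bound only for a bounded set; compactness of [X] bounds each of the finitely
   many functions [c(., y_k)]. *)
have bnd k : exists M, forall z, X z -> `|c z (y k)| <= M.
  have [|||z _ zP] := @compact_EVT_max _ R (fun z => `|c z (y k)|) X.
  - by exists x.
  - exact: X_compact.
  - apply: continuous_in_subspaceT => z /[!inE] Xz.
    exact: (cvg_norm (@c_continuous k z Xz)).
  - by exists `|c z (y k)| => w Xw; apply: zP; rewrite inE.
have /choice[M MP] := bnd.
exists (\sum_k `|M k|) => _ [z Xz [_ [k _ <-] <-]].
rewrite (bigD1 k)//= (le_trans (MP k z Xz))// (le_trans (ler_norm _))//.
by rewrite lerDl sumr_ge0.
Qed.

Lemma cost_diff_le i k x : X x -> `|d i k x| <= 2 * C.
Proof.
move=> Xx; rewrite (le_trans (ler_normB _ _))//.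
by rewrite mulr_natl mulr2n lerD// cost_le_norm.
Qed.

Lemma cost_norm_ge0 : 0 <= C.
Proof.
have [x Xx] : X !=set0.
  apply/set0P/eqP => X0; have := mu_X1; rewrite X0 measure0 => /eqP.
  by rewrite eq_sym onee_eq0.
exact: le_trans (cost_le_norm (Ordinal N_gt0) Xx).
Qed.

(** * Uniformly thin slabs and the variation of cell masses along coordinate directions *)

Section continuity.
Hypothesis level_null :
  forall i k t, i != k -> mu (X `&` d i k @^-1` [set t]) = 0%E.

(** For fixed [t] the slabs decrease to a null level set. A slightly wider slab absorbs a small
    change of [t], so smallness is locally uniform in [t], and compactness makes it uniform. *)
Lemma slab_small i k (e : R) : i != k -> 0 < e ->
  \forall delta \near 0^'+, forall t, (mu (slab i k t delta) < e%:E)%E.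
Proof.
move=> ik e0.
have le_slab t t' (r r' : R) : `|t - t'| + r <= r' ->
    (mu (slab i k t r) <= mu (slab i k t' r'))%E.
  move=> rr'; apply: le_measure; rewrite ?inE; [exact: measurable_slab..|].
  move=> x [Xx] /= xr; split=> //=; apply: le_trans rr'.
  by rewrite (le_trans (ler_distD t _ _))// distrC lerD2l.
have pointwise t : exists2 r, 0 < r & (mu (slab i k t r) < e%:E)%E.
  pose S m := slab i k t m.+1%:R^-1.
  have capS : \bigcap_m S m = X `&` d i k @^-1` [set t].
    apply/seteqP; split=> [x xS|x [Xx /= dx] m _]; last first.
      by split=> //=; rewrite dx subrr normr0 invr_ge0 ler0n.
    have Xx : X x by case: (xS 0%N I).
    split=> //=; apply/eqP; rewrite -subr_eq0 -normr_le0 leNgt; apply/negP.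
    move=> /ltr_add_invr[m]; rewrite add0r ltNge => /negP; apply.
    by have [_ /=] := xS m I; rewrite distrC.
  have : (mu \o S) @ \oo --> mu (\bigcap_m S m).
    apply: nonincreasing_cvg_mu.
    - by rewrite (le_lt_trans (probability_le1 _ _))// ?ltry//; exact: measurable_slab.
    - by move=> m; exact: measurable_slab.
    - by rewrite capS; apply: measurable_cost_diff; exact: closed_eq.
    - apply/nonincreasing_seqP => m; apply/subsetPset => x [Xx] /=.
      move=> xm; split=> //=; apply: le_trans xm _.
      by rewrite lef_pV2 ?posrE// ler_nat.
  rewrite capS level_null// => /fine_cvgP[_ /cvgrPdist_lt/(_ e e0)[m _ /(_ m)]].
  rewrite /= leqnn sub0r normrN => /(_ isT) mS; exists m.+1%:R^-1 => //.
  rewrite -[X in (X < _)%E]fineK ?fin_num_measure//; last exact: measurable_slab.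
  by rewrite lte_fin (le_lt_trans (ler_norm _)).
(* On [X] the cost difference is at most [2 * C] in absolute value, so for [r < 1] the slab around a
   level outside this segment is empty. *)
have K : compact `[- (2 * C + 1), 2 * C + 1]%classic by exact: segment_compact.
have cover := (compact_near_coveringP _).1 K _ (0^'+) (fun r t =>
  (mu (slab i k t r) < e%:E)%E) _.
have : \forall r \near 0^'+, `[- (2 * C + 1), 2 * C + 1]%classic `<=`
    (fun t => (mu (slab i k t r) < e%:E)%E).
  apply: cover => t _; have [r r0 tr] := pointwise t.
  have r2 : 0 < r / 2 by rewrite divr_gt0.
  exists (ball t (r / 2), [set r' | r' < r / 2]) => [|[t' r'] [/= tt' rr']].
    by split; [exact: nbhsx_ballx|exact: nbhs_right_lt].
  apply: le_lt_trans tr; apply: le_slab.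
  by rewrite distrC [leRHS]splitr; rewrite lerD// ltW.
move=> H; near=> r; move=> t.
have [tK|tK] := pselect (`[- (2 * C + 1), 2 * C + 1]%classic t).
  by move: t tK; near: r.
have r1 : r < 1 by near: r; exact: nbhs_right_lt.
rewrite (_ : slab i k t r = set0) ?measure0 ?lte_fin//.
apply/seteqP; split=> x // [Xx] /= xr; apply: tK => /=.
have := cost_diff_le i k Xx; move: xr; rewrite in_itv/= !ler_norml.
by move=> /andP[? ?] /andP[? ?]; apply/andP; lra.
Unshelve. all: by end_near. Qed.

Lemma mu_fineK (A : set 'rV[R]_n) : measurable A -> (fine (mu A))%:E = mu A.
Proof. by move=> mA; rewrite fineK// fin_num_measure. Qed.

Lemma fine_mu_cover (A : set 'rV[R]_n) (B : 'I_N -> set 'rV[R]_n) :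
  measurable A -> (forall j, measurable (B j)) -> A `<=` \bigcup_j B j ->
  fine (mu A) <= \sum_j fine (mu (B j)).
Proof.
move=> mA mB AB; rewrite -lee_fin mu_fineK// -sumEFin.
under eq_bigr do rewrite mu_fineK//.
rewrite fsbig_seq ?index_enum_uniq// (_ : [set` _] = setT).
  by apply: content_sub_fsum => //; exact: finite_finset.
by apply/seteqP; split=> // j _ /=; exact: mem_index_enum.
Qed.

Lemma measurable_Lag psi i : measurable (Lag X y c psi i).
Proof.
rewrite (_ : Lag _ _ _ _ _ = X `&` \bigcap_(j in [set: 'I_N])
    (X `&` d i j @^-1` [set s | s <= psi ord0 j - psi ord0 i])).
  apply: measurableI; first exact: measurable_X.
  apply: fin_bigcap_measurable => [|j _]; first exact: finite_finset.
  by apply: measurable_cost_diff; exact: closed_le.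
apply/seteqP; split=> [x [Xx xi]|x [Xx xi]]; split=> // j.
  by move=> _; split=> //=; have := xi j; rewrite /d; lra.
by have [_ /=] := xi j I; rewrite /d; lra.
Qed.

(** Lowering [psi^i] only tightens the inequalities that define the cell [j]. *)
Lemma Gmap_shift_neq psi (r : R) i j : 0 <= r -> j != i ->
  G (psi - r *: delta_mx ord0 i) ord0 j <= G psi ord0 j.
Proof.
move=> r0 ji; rewrite !mxE fine_le ?fin_num_measure//; try exact: measurable_Lag.
apply: le_measure; rewrite ?inE; try exact: measurable_Lag.
move=> x [Xx xj]; split=> // k; have := xj k.
rewrite shift_coord_neq// shift_coord => /le_trans; apply.
by rewrite lerD2l gerBl mulr_ge0.
Qed.

Lemma Gmap_pos_gap psi i j : 0 < G psi ord0 i -> psi ord0 i - psi ord0 j <= 2 * C.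
Proof.
rewrite mxE => Gi; have [x [Xx xi]] : Lag X y c psi i !=set0.
  by apply/set0P/eqP => L0; move: Gi; rewrite L0 measure0 ltxx.
have := xi j; have := cost_diff_le i j Xx.
by rewrite /d ler_norml => /andP[? ?]; lra.
Qed.

(** The cells cover [X], so their [N] masses add up to at least 1. *)
Lemma Gmap_dominant psi (e : R) : e * N%:R < 1 -> exists j, e < G psi ord0 j.
Proof.
move=> eN; apply/not_existsP => nG.
have : fine (mu X) <= \sum_j fine (mu (Lag X y c psi j)).
  apply: fine_mu_cover => [|j|x Xx]; [exact: measurable_X|exact: measurable_Lag|].
  have [j _ jP] := @arg_minP _ _ _ (Ordinal N_gt0) xpredT
    (fun j => c x (y j) + psi ord0 j) isT.
  by exists j => //; split=> // k; exact: jP.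
rewrite mu_X1 leNgt => /negP; apply; apply: le_lt_trans eN.
rewrite mulr_natr -[in leRHS](card_ord N) -sumr_const ler_sum// => j _.
by rewrite leNgt; apply/negP; have := nG j; rewrite mxE.
Qed.

Lemma Gmap_shift_full psi (r : R) i :
  (forall j, j != i -> 2 * C + psi ord0 i - psi ord0 j <= r) ->
  G (psi - r *: delta_mx ord0 i) ord0 i = 1.
Proof.
move=> rP; rewrite mxE (_ : Lag _ _ _ _ _ = X) ?mu_X1//.
apply/seteqP; split=> [x []//|x Xx]; split=> // j.
have [->//|ji] := eqVneq j i.
rewrite (shift_coord_neq _ _ ji) shift_coord eqxx mulr1.
have := rP j ji; have := cost_diff_le i j Xx.
by rewrite /d ler_norml => /andP[? ?]; lra.
Qed.

(** A point gained by the cell [i] violated some inequality against an index [j] by at most [delta],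
    hence lies in a thin slab around the old interface with [j]. Fewer than [N.+1] such slabs occur,
    each of mass below [e / N.+1]. *)
Lemma Gmap_shift_increment (e : R) : 0 < e -> exists2 delta : R, 0 < delta &
  forall psi (r : R) i, 0 <= r <= delta ->
    G (psi - r *: delta_mx ord0 i) ord0 i <= G psi ord0 i + e.
Proof.
move=> e0; pose e' := e / N.+1%:R; have e'0 : 0 < e' by rewrite divr_gt0.
have : \forall delta \near 0^'+, 0 < delta /\ forall i k : 'I_N, i != k ->
    forall t, (mu (slab i k t delta) < e'%:E)%E.
  apply: filterI; first exact: nbhs_right_gt.
  have F0 : Filter (0 : R)^'+ by exact: at_right_proper_filter.
  apply: (@filter_forall _ _ _ _ F0) => i; apply: (@filter_forall _ _ _ _ F0) => k.
  have [->|ik] := eqVneq i k; first exact: filterE.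
  by apply: filterS (slab_small ik e'0).
move=> /filter_ex[delta [delta0 small]]; exists delta => // psi r i /andP[r0 rd].
pose t j := psi ord0 j - psi ord0 i.
pose S j := if j == i then Lag X y c psi i else slab i j (t j) delta.
have mS j : measurable (S j).
  by rewrite /S; case: ifP => _; [exact: measurable_Lag|exact: measurable_slab].
rewrite mxE; apply: (@le_trans _ _ (\sum_j fine (mu (S j)))).
  apply: fine_mu_cover => //; first exact: measurable_Lag.
  move=> x [Xx xi]; have [xL|] := pselect (Lag X y c psi i x).
    by exists i => //; rewrite /S eqxx.
  move=> /not_andP[//|/existsNP[j /negP]]; rewrite -ltNge => xj.
  have ji : j != i by apply: contraTneq xj => ->; rewrite ltxx.
  exists j => //; rewrite /S (negPf ji); split=> //=.
  have := xi j; rewrite (shift_coord_neq _ _ ji) shift_coord eqxx mulr1.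
  by rewrite /t /d ler_norml => ?; apply/andP; lra.
rewrite (bigD1 i)//= {1}/S eqxx mxE lerD2l.
apply: (@le_trans _ _ (\sum_(j < N) e')).
  rewrite [leRHS](bigD1 i)//= ler_wpDl ?(ltW e'0)//; apply: ler_sum => j ji.
  rewrite -lee_fin mu_fineK// /S (negPf ji) ltW//.
  by apply: small; rewrite eq_sym.
rewrite sumr_const card_ord -mulr_natr /e' mulrAC ler_pdivrMr//.
by rewrite ler_pM2l// ler_nat.
Unshelve. all: by end_near. Qed.

(** Otherwise [X] would lie in the null zero level of a cost difference, against [mu X = 1]. Strict
    positivity keeps the step bound infinite when [L] is, since [0 * +oo = 0]. *)
Lemma cost_norm_gt0 i k : i != k -> 0 < C.
Proof.
move=> ik; rewrite lt_neqAle cost_norm_ge0 andbT; apply: contraTneq isT => C0.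
have XX : X `<=` X `&` d i k @^-1` [set 0].
  move=> x Xx; split=> //=; apply/eqP; rewrite -normr_le0.
  by rewrite (le_trans (cost_diff_le i k Xx))// -C0 mulr0.
have : mu X = 0%E.
  apply: (subset_measure0 _ _ XX (level_null 0 ik)); first exact: measurable_X.
  exact: measurable_cost_diff.
rewrite mu_X1 => /eqP.
by rewrite onee_eq0.
Qed.

(** A discrete intermediate value argument: each shift by [delta] adds at most [e] to the mass, so
    the first multiple of [delta] that reaches [2 * e] does not overshoot [3 * e]. *)
Lemma Gmap_shift_exists psi i (e : R) : 0 < e -> 2 * e <= 1 ->
  G psi ord0 i <= e ->
  exists2 r : R, 0 < r & 2 * e <= G (psi - r *: delta_mx ord0 i) ord0 i <= 3 * e.
Proof.
move=> e0 e1 Ge; have [delta delta0 incr] := Gmap_shift_increment e0.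
pose a m := G (psi - (m%:R * delta) *: delta_mx ord0 i) ord0 i.
have a0 : a 0%N <= e by rewrite /a mul0r scale0r subr0.
have aS m : a m.+1 <= a m + e.
  have := incr (psi - (m%:R * delta) *: delta_mx ord0 i) delta i.
  rewrite lexx ltW// -addrA -opprD -scalerDl => /(_ isT).
  by rewrite /a -natr1 mulrDl mul1r.
have ex_a : exists m, 2 * e <= a m.
  (* [M] dominates every length required by [Gmap_shift_full]; after such a shift the cell is all of
     [X], of mass 1. *)
  pose M := \sum_j `|2 * C + psi ord0 i - psi ord0 j|.
  exists (Num.truncn (M / delta)).+1; rewrite /a Gmap_shift_full// => j ji.
  apply: (@le_trans _ _ M).
    by rewrite /M (bigD1 j)//= (le_trans (ler_norm _))// lerDl sumr_ge0.
  by rewrite -ler_pdivrMr// ltW// truncnS_gt.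
case: (ex_minnP ex_a) => -[|m] am minm.
  by have := le_trans am a0; lra.
exists (m.+1%:R * delta); first by rewrite mulr_gt0.
apply/andP; split=> //; have : a m < 2 * e.
  by rewrite ltNge; apply/negP => /minm; rewrite ltnn.
by have := aS m; rewrite -/(a m.+1); lra.
Qed.

End continuity.
End laguerre.

(** * Integrals over null sets, the Euclidean norm and Lipschitz constants *)

Import HBNNSimple.

(** No measurability of [f] is at hand, so the integral is unfolded into the supremum over the
    simple functions below [f], each of which integrates to 0. *)
Lemma integral_measure0 d (T : measurableType d) (R : realType)
    (mu : {measure set T -> \bar R}) (A : set T) (f : T -> \bar R) :
  measurable A -> (forall x, A x -> 0 <= f x)%E -> mu A = 0%E ->
  (\int[mu]_(x in A) f x = 0)%E.
Proof.
move=> mA f0 A0; apply/eqP; rewrite eq_le integral_ge0// andbT.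
rewrite ge0_integralE//; apply: ge_ereal_sup => _ /= [h hf <-].
rewrite -integralT_nnsfun (_ : (fun x => _) = (EFin \o h) \_ A).
  rewrite -integral_mkcond null_set_integral//.
  by apply/measurable_EFinP; exact: measurable_funTS.
apply/funext => x; rewrite patchE; case: ifPn => // /negP xA.
apply/le_anti/andP; split; last by rewrite /= lee_fin.
by have := hf x; rewrite patchE (negPf (introN idP xA)).
Qed.

Lemma enorm_ge_coord (R : realType) m (u : 'rV[R]_m) i : `|u ord0 i| <= enorm u.
Proof.
rewrite -sqrtr_sqr ler_wsqrtr// (bigD1 i)//= lerDl.
by apply: sumr_ge0 => j _; exact: sqr_ge0.
Qed.

Lemma enorm_delta (R : realType) m (i : 'I_m) (r : R) :
  enorm (r *: delta_mx ord0 i) = `|r|.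
Proof.
rewrite /enorm (bigD1 i)//= big1 => [|j ji]; last first.
  by rewrite !mxE eqxx (negPf ji) mulr0 expr0n.
by rewrite !mxE !eqxx mulr1 addr0 sqrtr_sqr.
Qed.

Lemma lipschitz_constant_ge0 (R : realType) m p (F : 'rV[R]_m -> 'rV[R]_p) :
  (0 <= lipschitz_constant F)%E.
Proof. by apply: le_ereal_inf_tmp => _ [K [K0 _] <-]; rewrite lee_fin. Qed.

(** Taking [K] strictly above the infimum avoids deciding whether it is attained. *)
Lemma lipschitz_constant_lt (R : realType) m p (F : 'rV[R]_m -> 'rV[R]_p) (K : R) :
  (lipschitz_constant F < K%:E)%E ->
  0 < K /\ forall u v, enorm (F u - F v) <= K * enorm (u - v).
Proof.
move=> LK; split.
  by rewrite -lte_fin; exact: le_lt_trans (lipschitz_constant_ge0 F) LK.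
have [_ [K' [K'0 K'P] <-]] := ereal_inf_lt LK.
rewrite lte_fin => K'K u v; apply: le_trans (K'P u v) _.
by apply: ler_wpM2r; [exact: sqrtr_ge0|exact: ltW].
Qed.

(** * Level sets of cost differences under [mu] *)

Section level_mu.
Variables (R : realType) (n N : nat) (X : set 'rV[R]_n) (y : 'I_N -> 'rV[R]_n).
Variables (c : 'rV[R]_n -> 'rV[R]_n -> R) (mu : probability 'rV[R]_n R).
Hypothesis X_compact : compact X.
Hypothesis c_reg : Reg X y c.

Lemma Reg_continuous i x : X x -> {for x, continuous (fun z => c z (y i))}.
Proof.
move=> Xx; have [U [oU XU C2]] := c_reg i.
by apply: (Ck_on_open1_continuous oU _ (XU _ Xx)); exact: Ck_on_open2_1.
Qed.

(** By (Twist), at each point of [X] some partial derivative of the difference is nonzero, so the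
    level set is Lebesgue null; the density carries this over to [mu]. *)
Lemma cost_diff_level_mu0 rho i k (t : R) :
  supported_with_density X mu rho -> Twist X y c -> i != k ->
  mu (X `&` (fun x => c x (y i) - c x (y k)) @^-1` [set t]) = 0%E.
Proof.
move=> [_ rho0 muE] twist ik; set A := X `&` _.
have mA : measurable A.
  exact: (measurable_cost_diff X_compact Reg_continuous i k (@closed_eq _ t)).
have AX : A `<=` X by move=> x [].
rewrite muE//; apply: integral_measure0 => // [x /AX/rho0|].
  by rewrite lee_fin.
have [U [oU XU C2U]] := c_reg i; have [V [oV XV C2V]] := c_reg k.
have oUV : open (U `&` V) by exact: openI.
have C1i : Ck_on_open 1 (U `&` V) (fun x => c x (y i)).
  by apply: Ck_on_openS (Ck_on_open2_1 oU C2U) => x [].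
have C1k : Ck_on_open 1 (U `&` V) (fun x => c x (y k)).
  by apply: Ck_on_openS (Ck_on_open2_1 oV C2V) => x [].
have [C1 DE] := Ck_on_openB oUV C1i C1k.
apply: (level_set_lebesgue0 t X_compact oUV _ C1) => [x Xx|x Xx].
  by split; [exact: XU|exact: XV].
apply/not_existsP => D0; apply: (twist x i k Xx); first exact/eqP.
apply/rowP => j; rewrite !mxE; apply/eqP; rewrite -subr_eq0 -DE.
  by apply/negP => /negP; exact: D0.
by split; [exact: XU|exact: XV].
Qed.

End level_mu.

Theorem proposition3p1 (R : realType) (N n : nat) (N_ge1 : (1 <= N)%N)
  (n_ge2 : (2 <= n)%N)
  (X : set 'rV[R]_n) (X_compact : compact X)
  (y : 'I_N -> 'rV[R]_n) (y_inj : injective y)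
  (c : 'rV[R]_n -> 'rV[R]_n -> R)
  (mu : probability 'rV[R]_n R) (rho : 'rV[R]_n -> R)
  (mu_rho : supported_with_density X mu rho)
  (alpha : R) (alpha_gt0 : 0 < alpha) (alpha_le1 : alpha <= 1)
  (rho_holder : holder_on alpha X rho)
  (c_reg : Reg X y c) (c_twist : Twist X y c)
  (D : 'I_N -> set 'rV[R]_n) (ex : 'I_N -> 'rV[R]_n -> 'rV[R]_n)
  (c_qc : QC X y c D ex) (X_convex : c_convex X D ex)
  (eps : R) (eps_gt0 : 0 < eps) (eps_lt : eps < 1 / (3 * N%:R))
  (psi_in : 'rV[R]_N) :
  let G := Gmap X y c mu in
  let L := lipschitz_constant G in
  shuffle_terminates_in G eps psi_in
    ((N%:R - 1)%:E * (4%:E * L * (cost_norm X y c)%:E * (eps^-1)%:E + 1))%E.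
Proof.
move=> G L; pose C := cost_norm X y c.
have muXC : mu (~` X) = 0%E by case: mu_rho.
have cc := Reg_continuous c_reg.
have null (i k : 'I_N) t (ik : i != k) := cost_diff_level_mu0 X_compact c_reg t mu_rho c_twist ik.
have N0 : 0 < N%:R :> R by rewrite ltr0n.
have epsN : 3 * eps * N%:R < 1.
  by move: eps_lt; rewrite ltr_pdivlMr ?mulr_gt0// mulrA [eps * 3]mulrC.
have eps2 : 2 * eps <= 1.
  have N1 : 1 <= N%:R :> R by rewrite ler1n.
  have : 3 * eps <= 3 * eps * N%:R by rewrite ler_peMr// mulr_ge0// ltW.
  by lra.
have dominant psi := Gmap_dominant X_compact N_ge1 muXC cc psi epsN.
have shift_neq := Gmap_shift_neq mu X_compact cc.
have gap psi i j : 0 < G psi ord0 i -> psi ord0 i - psi ord0 j <= 2 * C.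
  exact: Gmap_pos_gap.
have C0 : 0 <= C := cost_norm_ge0 X_compact N_ge1 muXC cc.
(* Left open in the step length: it serves with the [delta] obtained from continuity and with
   [eps / K] for [K > L]. *)
have bound delta (delta0 : 0 < delta) stepG :=
  @shuffle_run_bound R N G eps eps_gt0 dominant shift_neq C gap C0 delta delta0 stepG.
(* With rise at most [eps / 2], a step shorter than [delta] ends at most at [3 / 2 * eps], short of
   [2 * eps]. *)
have [delta delta0 incr] : exists2 delta : R, 0 < delta &
    forall psi (r : R) i, 0 <= r <= delta ->
    G (psi - r *: delta_mx ord0 i) ord0 i <= G psi ord0 i + eps / 2.
  by apply: Gmap_shift_increment => //; rewrite divr_gt0.
have stepG psi r i : G psi ord0 i <= eps -> 0 < r ->
    2 * eps <= G (psi - r *: delta_mx ord0 i) ord0 i -> delta <= r.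
  move=> Gi r0 Gr; rewrite leNgt; apply/negP => rd.
  by have := incr psi r i; rewrite (ltW r0) (ltW rd) => /(_ isT); lra.
apply: (shuffle_terminates eps_gt0 dominant shift_neq gap C0 delta0 stepG).
  by move=> psi i Gi; apply: Gmap_shift_exists.
move=> k s run.
(* For [N = 1] the factor [N - 1] annihilates even an infinite [L]; the bound with the crude [delta]
   already excludes any update. *)
have [N1|N2] := leqP N 1.
  have N10 : N%:R - 1 = 0 :> R.
    by rewrite (_ : N = 1%N) ?subrr//; apply/eqP; rewrite eqn_leq N1.
  by have := bound _ delta0 stepG psi_in k s run; rewrite N10 mul0r mul0e lee_fin.
have NM : 0 < N%:R - 1 :> R by rewrite subr_gt0 ltr1n.
have C_gt0 : 0 < C.
  by apply: (@cost_norm_gt0 _ _ _ _ y c mu X_compact N_ge1 muXC cc null (Ordinal N_ge1) (Ordinal N2)).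
have [Ly|] := eqVneq L +oo%E.
  rewrite Ly gt0_muley ?lte_fin// gt0_mulye ?lte_fin// gt0_mulye ?lte_fin ?invr_gt0//.
  by rewrite addye// gt0_muley ?lte_fin// leey.
rewrite -ltey => Loo.
have Lfin : L \is a fin_num by rewrite ge0_fin_numE// lipschitz_constant_ge0.
have LE : L = (fine L)%:E by rewrite fineK.
rewrite LE -!EFinM lee_fin.
(* An update raises [G^i] by at least [eps], so its length is at least [eps / K]. *)
have main K : fine L < K -> k%:R <= (N%:R - 1) * (4 * K * C * eps^-1 + 1).
  rewrite -lte_fin -LE => /lipschitz_constant_lt[K0 KP].
  have -> : 4 * K * C * eps^-1 = 4 * C / (eps / K).
    by field; rewrite !gt_eqF.
  apply: bound run; first exact: divr_gt0.
  move=> psi r i Gi r0 Gr; rewrite ler_pdivrMr//.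
  have := KP (psi - r *: delta_mx ord0 i) psi.
  have -> : enorm (psi - r *: delta_mx ord0 i - psi) = r.
    by rewrite addrAC subrr sub0r -scaleNr enorm_delta normrN gtr0_norm.
  rewrite mulrC; apply: le_trans; apply: le_trans (enorm_ge_coord _ i).
  rewrite [X in `|X|]mxE [X in _ + X]mxE; apply: le_trans (ler_norm _).
  by lra.
(* [a] is the slope of the bound in [K]: at [K = L + e / a] it exceeds its value at [L] by exactly
   [e], which is arbitrary. *)
pose a := (N%:R - 1) * 4 * C * eps^-1.
have a0 : 0 < a by rewrite !mulr_gt0// invr_gt0.
apply/ler_addgt0Pr => e e0.
have := main (fine L + e / a); rewrite ltrDl divr_gt0// => /(_ isT) /le_trans; apply.
have {2}-> : e = a * (e / a) by rewrite mulrC divfK// gt_eqF.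
by rewrite -/C /a le_eqVlt; apply/orP; left; apply/eqP; ring.
Qed.
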